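(* Let $l,k,\rho,\gamma,q_0,h_0,D_\infty>0$ and $0<\epsilon<1$ be given, and consider the specific heat $c>0$ as an unknown of the free boundary problem (P) described in the context. Then the solution of (P), including the unknown coefficient $c$, is given by, with $\alpha=\frac{k}{\rho c}$, $$T(x,t)=\frac{q_0\sqrt{\pi\alpha}}{k}\left[\operatorname{erf}\left(\frac{x}{2\sqrt{\alpha t}}\right)-\operatorname{erf}(\xi)\right]\quad (0<x<s(t),\ t>0),$$ $$s(t)=2\xi\sqrt{\alpha t},\qquad r(t)=2\left[\xi+\frac{\gamma k}{2q_0\sqrt{\alpha}}\exp(\xi^2)\right]\sqrt{\alpha t}\quad (t>0),$$ with $c>0$ given by $$c=\frac{\pi}{\rho k}\left[\frac{q_0\operatorname{erf}(\xi)}{D_\infty\left(1-\frac{q_0}{h_0D_\infty}\right)}\right]^2$$ and $\xi>0$ the unique solution of the equation $$f_6(x)=\frac{q_0^2\sqrt\pi}{\rho l k D_\infty\left(1-\frac{q_0}{h_0D_\infty}\right)},\quad x>0,$$ where $$f_6(x)=\left[\frac{x}{\operatorname{erf}(x)}+\frac{\gamma\sqrt\pi(1-\epsilon)}{2D_\infty\left(1-\frac{q_0}{h_0D_\infty}\right)}\exp(x^2)\right]\exp(x^2),\quad x>0,$$ if and only if the following two inequalities hold: $$1-\frac{q_0}{h_0D_\infty}>0,\qquad 1-\frac{q_0}{h_0D_\infty}<\frac{1}{D_\infty}\left[\frac{2q_0^2}{\rho l k}-\gamma(1-\epsilon)\right].$$ (That is: there exist $c>0$ and $\xi>0$ such that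 the triple $(T,s,r)$ with $T(x,t)=\frac{q_0\sqrt{\pi\alpha}}{k}\left[\operatorname{erf}\left(\frac{x}{2\sqrt{\alpha t}}\right)-\operatorname{erf}(\xi)\right]$, $s(t)=2\xi\sqrt{\alpha t}$ and $r(t)=2\left[\xi+\frac{\gamma k}{2q_0\sqrt{\alpha}}\exp(\xi^2)\right]\sqrt{\alpha t}$ solves (P) if and only if these inequalities hold, and in that case the equation $f_6(x)=\frac{q_0^2\sqrt\pi}{\rho l k D_\infty\left(1-\frac{q_0}{h_0D_\infty}\right)}$ has a unique positive solution, $\xi$ is this solution, and $c=\frac{\pi}{\rho k}\left[\frac{q_0\operatorname{erf}(\xi)}{D_\infty\left(1-\frac{q_0}{h_0D_\infty}\right)}\right]^2$.)
   Context: Problem (P): find $T=T(x,t)$ and free boundaries $x=s(t)$, $x=r(t)$ such that $$\rho c\,T_t(x,t)-kT_{xx}(x,t)=0,\quad 0<x<s(t),\ t>0;$$ $$T(s(t),t)=0,\quad t>0;$$ $$kT_x(s(t),t)=\rho l\,[\epsilon\dot s(t)+(1-\epsilon)\dot r(t)],\quad t>0;$$ $$T_x(s(t),t)\,(r(t)-s(t))=\gamma,\quad t>0;$$ $$r(0)=s(0)=0;$$ $$kT_x(0,t)=\frac{q_0}{\sqrt t},\quad t>0;$$ $$kT_x(0,t)=\frac{h_0}{\sqrt t}\,(T(0,t)+D_\infty),\quad t>0.$$ All parameters $l,k,\rho,c,\gamma,q_0,h_0,D_\infty$ are positive real constants and $0<\epsilon<1$. Here $T$ and $T_x$ at $x=0$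 and $x=s(t)$ are the boundary values from $0<x<s(t)$. The error function is $\operatorname{erf}(x)=\frac{2}{\sqrt\pi}\int_0^x e^{-u^2}\,du$. *)

(* Defs.v *)
From Stdlib Require Export Reals.
From Coquelicot Require Export Coquelicot.
Open Scope R_scope.

Definition erf (x : R) : R :=
  2 / sqrt PI * RInt (fun u => exp (- (u ^ 2))) 0 x.

Definition Dt (T : R -> R -> R) (x t : R) : R := Derive (fun tau => T x tau) t.
Definition Dx (T : R -> R -> R) (x t : R) : R := Derive (fun y => T y t) x.
Definition Dxx (T : R -> R -> R) (x t : R) : R := Dx (Dx T) x t.

(** [T] is a total function, but only its values on the region
    [0 < x < s t], [0 < t] matter: every condition on the fixed face [x = 0] or
    on the free boundary [x = s t] is imposed on the one-sided limit taken
    from inside the region.  Since [Derive] is total, all the derivatives that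
    occur are also required to exist.  The initial condition on the free
    boundaries includes their right-continuity at [t = 0]. *)
Record solves_P (l k rho c gamma q0 h0 Dinf eps : R)
    (T : R -> R -> R) (s r : R -> R) : Prop := {
  P_region : forall t, 0 < t -> 0 < s t;
  P_regular : forall x t, 0 < t -> 0 < x < s t ->
    ex_derive (fun tau => T x tau) t /\
    ex_derive (fun y => T y t) x /\
    ex_derive (fun y => Dx T y t) x;
  P_heat : forall x t, 0 < t -> 0 < x < s t ->
    rho * c * Dt T x t - k * Dxx T x t = 0;
  P_free_regular : forall t, 0 < t -> ex_derive s t /\ ex_derive r t;
  P_free_temperature : forall t, 0 < t ->
    filterlim (fun x => T x t) (at_left (s t)) (locally 0);
  P_free_flux : forall t, 0 < t -> exists Tx_s : R,
    filterlim (fun x => Dx T x t) (at_left (s t)) (locally Tx_s) /\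
    k * Tx_s = rho * l * (eps * Derive s t + (1 - eps) * Derive r t) /\
    Tx_s * (r t - s t) = gamma;
  P_initial : s 0 = 0 /\ r 0 = 0 /\
    filterlim s (at_right 0) (locally 0) /\
    filterlim r (at_right 0) (locally 0);
  P_fixed_face : forall t, 0 < t -> exists T_0 Tx_0 : R,
    filterlim (fun x => T x t) (at_right 0) (locally T_0) /\
    filterlim (fun x => Dx T x t) (at_right 0) (locally Tx_0) /\
    k * Tx_0 = q0 / sqrt t /\
    k * Tx_0 = h0 / sqrt t * (T_0 + Dinf)
}.

Definition diffusivity (k rho c : R) : R := k / (rho * c).

Definition T_sol (k q0 alpha xi : R) (x t : R) : R :=
  q0 * sqrt (PI * alpha) / k * (erf (x / (2 * sqrt (alpha * t))) - erf xi).

Definition s_sol (alpha xi : R) (t : R) : R := 2 * xi * sqrt (alpha * t).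

Definition r_sol (k gamma q0 alpha xi : R) (t : R) : R :=
  2 * (xi + gamma * k / (2 * q0 * sqrt alpha) * exp (xi ^ 2)) * sqrt (alpha * t).

Definition explicit_solves_P (l k rho c gamma q0 h0 Dinf eps xi : R) : Prop :=
  let alpha := diffusivity k rho c in
  solves_P l k rho c gamma q0 h0 Dinf eps
    (T_sol k q0 alpha xi) (s_sol alpha xi) (r_sol k gamma q0 alpha xi).

Definition f6 (gamma q0 h0 Dinf eps x : R) : R :=
  (x / erf x
   + gamma * sqrt PI * (1 - eps) / (2 * Dinf * (1 - q0 / (h0 * Dinf)))
     * exp (x ^ 2)) * exp (x ^ 2).

Definition f6_equation (l k rho gamma q0 h0 Dinf eps x : R) : Prop :=
  f6 gamma q0 h0 Dinf eps x
  = q0 ^ 2 * sqrt PI / (rho * l * k * Dinf * (1 - q0 / (h0 * Dinf))).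

Definition c_formula (k rho q0 h0 Dinf xi : R) : R :=
  PI / (rho * k) * (q0 * erf xi / (Dinf * (1 - q0 / (h0 * Dinf)))) ^ 2.

Definition data_inequalities (l k rho gamma q0 h0 Dinf eps : R) : Prop :=
  0 < 1 - q0 / (h0 * Dinf) /\
  1 - q0 / (h0 * Dinf)
  < 1 / Dinf * (2 * q0 ^ 2 / (rho * l * k) - gamma * (1 - eps)).

(* Main.v *)
(** With [alpha = k / (rho * c)], the proposed triple satisfies every condition of
    (P) identically except two: the convective condition at [x = 0], which fixes
    [sqrt alpha] (hence [c]) in terms of [xi] and forces [1 - q0 / (h0 * Dinf) > 0],
    and the Stefan condition, which then becomes the equation for [f6].
    Since [erf] is concave on the positive axis, [x / erf x] is nondecreasing and
    [f6] is strictly increasing.  The bounds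
    [x * exp (- x ^ 2) <= sqrt PI / 2 * erf x <= x]
    squeeze [f6 x] between [A * exp (x ^ 2)] and [A * exp (2 * x ^ 2)], where [A] is
    the limit of [f6] at [0].  So the equation is solvable exactly when [A] is below
    its right-hand side, which is the second inequality. *)

Require Import Defs.
From Stdlib Require Import Reals Lra.
From Coquelicot Require Import Coquelicot.
Open Scope R_scope.

(** * Derivative and elementary estimates of the error function *)

Lemma sqrt_PI_pos : 0 < sqrt PI.
Proof. apply sqrt_lt_R0, PI_RGT_0. Qed.

Lemma is_derive_erf (x : R) :
  is_derive erf x (2 / sqrt PI * exp (- (x ^ 2))).
Proof.
  unfold erf. apply (is_derive_scal (fun x => RInt _ 0 x)).
  assert (Hc : forall y, continuous (fun u => exp (- (u ^ 2))) y).
  { intros y. apply (ex_derive_continuous (fun u => exp (- (u ^ 2)))).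
    auto_derive; auto. }
  apply (is_derive_RInt (fun u => exp (- (u ^ 2))) _ 0); [|apply Hc].
  apply filter_forall; intros y.
  apply (RInt_correct (V := R_CompleteNormedModule)),
    ex_RInt_continuous; intros; apply Hc.
Qed.

Lemma erf_0 : erf 0 = 0.
Proof. unfold erf. rewrite RInt_point. unfold zero; simpl. ring. Qed.

Lemma exp_sqr_le (a b : R) : 0 <= a <= b -> exp (a ^ 2) <= exp (b ^ 2).
Proof.
  intros H. destruct (Req_dec (a ^ 2) (b ^ 2)) as [->|Hne]; [lra|].
  left. apply exp_increasing. nra.
Qed.

Lemma exp_neg_sqr_le (a b : R) : 0 <= a <= b -> exp (- b ^ 2) <= exp (- a ^ 2).
Proof.
  intros H. rewrite !exp_Ropp.
  apply Rinv_le_contravar; [apply exp_pos | now apply exp_sqr_le].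
Qed.

(** Mean value theorem: at the intermediate point the derivative of [sqrt PI / 2 * erf] lies between
    its values at [b] and [a], because it decreases on the nonnegative axis. This is the
    quantitative form of concavity on which all later bounds rest. *)
Lemma erf_increment (a b : R) : 0 <= a < b ->
  (b - a) * exp (- b ^ 2) <= sqrt PI / 2 * (erf b - erf a)
  <= (b - a) * exp (- a ^ 2).
Proof.
  intros Hab. pose proof sqrt_PI_pos as Hp.
  destruct (MVT_gen erf a b (fun x => 2 / sqrt PI * exp (- (x ^ 2))))
    as [c [Hc ->]].
  - intros; apply is_derive_erf.
  - intros x _. apply continuity_pt_filterlim.
    apply (ex_derive_continuous erf). eexists; apply is_derive_erf.
  - rewrite Rmin_left, Rmax_right in Hc by lra.
    replace (sqrt PI / 2 * (2 / sqrt PI * exp (- c ^ 2) * (b - a)))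
      with ((b - a) * exp (- c ^ 2)) by (field; lra).
    split; apply Rmult_le_compat_l; try lra; apply exp_neg_sqr_le; lra.
Qed.

Lemma erf_bounds (x : R) : 0 < x ->
  x * exp (- x ^ 2) <= sqrt PI / 2 * erf x <= x.
Proof.
  intros Hx. pose proof (erf_increment 0 x ltac:(lra)) as H.
  rewrite erf_0, !Rminus_0_r in H.
  replace (- 0 ^ 2) with 0 in H by ring. rewrite exp_0 in H. lra.
Qed.

Lemma erf_pos (x : R) : 0 < x -> 0 < erf x.
Proof.
  intros Hx. pose proof (erf_bounds x Hx). pose proof sqrt_PI_pos.
  pose proof (Rmult_lt_0_compat _ _ Hx (exp_pos (- x ^ 2))).
  apply Rmult_lt_reg_l with (sqrt PI / 2); lra.
Qed.

Lemma id_div_erf_bounds (x : R) : 0 < x ->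
  sqrt PI / 2 <= x / erf x <= sqrt PI / 2 * exp (x ^ 2).
Proof.
  intros Hx. pose proof (erf_bounds x Hx) as [H1 H2].
  pose proof (erf_pos x Hx) as He. pose proof (exp_pos (x ^ 2)) as Hw.
  split.
  - apply Rmult_le_reg_r with (erf x); trivial.
    replace (x / erf x * erf x) with x by (field; lra). lra.
  - apply Rmult_le_reg_r with (erf x); trivial.
    replace (x / erf x * erf x) with x by (field; lra).
    rewrite exp_Ropp in H1.
    apply Rmult_le_compat_r with (r := exp (x ^ 2)) in H1; [|lra].
    replace (x * / exp (x ^ 2) * exp (x ^ 2)) with x in H1 by (field; lra).
    lra.
Qed.

Lemma id_div_erf_le (x y : R) : 0 < x < y -> x / erf x <= y / erf y.
Proof.
  intros H. pose proof sqrt_PI_pos as Hp.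
  pose proof (erf_increment x y ltac:(lra)) as [_ H1].
  pose proof (erf_bounds x ltac:(lra)) as [H2 _].
  pose proof (erf_pos x ltac:(lra)). pose proof (erf_pos y ltac:(lra)).
  (* [erf] lies below its tangent at [x] to the right of [x], and the slope of
     that tangent is at most the slope of the chord from [0] to [x]. *)
  assert (Hc : x * erf y <= y * erf x).
  { apply Rmult_le_reg_l with (sqrt PI / 2); [lra|].
    apply Rmult_le_compat_l with (r := x) in H1; [|lra].
    apply Rmult_le_compat_l with (r := y - x) in H2; [|lra]. nra. }
  apply Rmult_le_reg_r with (erf x * erf y); [nra|].
  replace (x / erf x * (erf x * erf y)) with (x * erf y) by (field; lra).
  replace (y / erf y * (erf x * erf y)) with (y * erf x) by (field; lra).
  trivial.
Qed.

(** * Derivatives of the explicit temperature and of the free boundaries *)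

(** Used to replace [alpha] and [t] by squares, so that their square roots become variables and
    [field] can close the derivative computations. *)
Lemma pos_square (a : R) : 0 < a -> exists b, 0 < b /\ a = b * b.
Proof.
  intros Ha. exists (sqrt a). split; [now apply sqrt_lt_R0|].
  symmetry; apply sqrt_def; lra.
Qed.

Lemma sqrt_mult_squares (a b : R) : 0 < a -> 0 < b ->
  sqrt (a * a * (b * b)) = a * b.
Proof. intros. rewrite sqrt_mult, !sqrt_square; nra. Qed.

Lemma sqrt_mult_square (x a : R) : 0 < x -> 0 < a ->
  sqrt (x * (a * a)) = sqrt x * a.
Proof. intros. rewrite sqrt_mult, sqrt_square; nra. Qed.

Lemma Dx_T_sol (k q0 alpha xi x t : R) : 0 < k -> 0 < alpha -> 0 < t ->
  is_derive (fun y : R => T_sol k q0 alpha xi y t) x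
    (q0 / (k * sqrt t) * exp (- (x / (2 * sqrt (alpha * t))) ^ 2)).
Proof.
  intros Hk Ha Ht. unfold T_sol.
  pose proof sqrt_PI_pos. pose proof PI_RGT_0.
  destruct (pos_square alpha Ha) as [a [Hpa ->]].
  destruct (pos_square t Ht) as [b [Hpb ->]].
  rewrite sqrt_mult_squares, sqrt_mult_square, sqrt_square by lra.
  auto_derive; [eexists; apply is_derive_erf|].
  rewrite (is_derive_unique _ _ _ (is_derive_erf _)). unfold Rdiv.
  field. repeat split; lra.
Qed.

Lemma Dt_T_sol (k q0 alpha xi x t : R) : 0 < k -> 0 < alpha -> 0 < t ->
  is_derive (fun tau : R => T_sol k q0 alpha xi x tau) t
    (- (q0 * x / (2 * k * t * sqrt t))
     * exp (- (x / (2 * sqrt (alpha * t))) ^ 2)).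
Proof.
  intros Hk Ha Ht. unfold T_sol.
  pose proof sqrt_PI_pos. pose proof PI_RGT_0.
  destruct (pos_square alpha Ha) as [a [Hpa ->]].
  destruct (pos_square t Ht) as [b [Hpb ->]].
  pose proof (sqrt_mult_squares a b Hpa Hpb) as Hab.
  auto_derive; rewrite Hab; [repeat split; try nra; eexists; apply is_derive_erf|].
  rewrite (is_derive_unique _ _ _ (is_derive_erf _)). unfold Rdiv.
  rewrite sqrt_mult_square, sqrt_square by lra.
  field. repeat split; lra.
Qed.

Lemma Dxx_T_sol (k q0 alpha xi x t : R) : 0 < k -> 0 < alpha -> 0 < t ->
  is_derive (fun y : R => Defs.Dx (T_sol k q0 alpha xi) y t) x
    (- (q0 * x / (2 * alpha * k * t * sqrt t))
     * exp (- (x / (2 * sqrt (alpha * t))) ^ 2)).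
Proof.
  intros Hk Ha Ht.
  apply is_derive_ext with (f := fun x =>
    q0 / (k * sqrt t) * exp (- (x / (2 * sqrt (alpha * t))) ^ 2)).
  { intros y. symmetry. now apply is_derive_unique, Dx_T_sol. }
  destruct (pos_square alpha Ha) as [a [Hpa ->]].
  destruct (pos_square t Ht) as [b [Hpb ->]].
  rewrite sqrt_mult_squares, sqrt_square by lra.
  auto_derive; trivial. unfold Rdiv.
  replace (x * / (2 * (a * b)) * (x * / (2 * (a * b)) * 1))
    with ((x * / (2 * (a * b))) ^ 2) by ring.
  field. repeat split; lra.
Qed.

(** Covers both free boundaries, which differ only in the constant [m]. *)
Lemma is_derive_free_boundary (m alpha t : R) : 0 < alpha -> 0 < t ->
  is_derive (fun tau => 2 * m * sqrt (alpha * tau)) t (m * sqrt alpha / sqrt t).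
Proof.
  intros Ha Ht.
  destruct (pos_square alpha Ha) as [a [Hpa ->]].
  destruct (pos_square t Ht) as [b [Hpb ->]].
  pose proof (sqrt_mult_squares a b Hpa Hpb) as Hab.
  auto_derive; [nra|]. rewrite Hab, !sqrt_square by lra. field; lra.
Qed.

Lemma free_boundary_initial (m alpha : R) :
  filterlim (fun tau => 2 * m * sqrt (alpha * tau)) (at_right 0) (locally 0).
Proof.
  eapply filterlim_filter_le_1; [apply filter_le_within|].
  replace 0 with (2 * m * sqrt (alpha * 0)) at 2
    by (rewrite Rmult_0_r, sqrt_0; ring).
  apply (continuous_scal_r (2 * m) (fun tau => sqrt (alpha * tau))).
  apply continuous_comp with (f := fun tau => alpha * tau) (g := sqrt).
  - apply (ex_derive_continuous (fun tau => alpha * tau)). now auto_derive.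
  - apply continuous_sqrt.
Qed.

(** * Reduction of (P) to two scalar equations *)

Lemma filterlim_within_derive (D : R -> Prop) (f : R -> R) (x l : R) :
  is_derive f x l -> filterlim f (within D (locally x)) (locally (f x)).
Proof.
  intros Hf. eapply filterlim_filter_le_1; [apply filter_le_within|].
  apply (ex_derive_continuous f). now exists l.
Qed.

(* At [x = s t] and at [x = 0] the factors [1 / sqrt t] cancel, which leaves one
   equation in [alpha] and [xi] for the Stefan condition and one for the
   convective condition; all the other conditions hold identically. *)
Lemma explicit_solves_P_iff (l k rho c gamma q0 h0 Dinf eps xi : R) :
  0 < l -> 0 < k -> 0 < rho -> 0 < c -> 0 < q0 -> 0 < h0 -> 0 < xi ->
  let alpha := diffusivity k rho c in
  explicit_solves_P l k rho c gamma q0 h0 Dinf eps xi <->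
  q0 * exp (- xi ^ 2)
  = rho * l * sqrt alpha
    * (xi + (1 - eps) * (gamma * k / (2 * q0 * sqrt alpha) * exp (xi ^ 2)))
  /\ q0 = h0 * (Dinf - q0 * sqrt (PI * alpha) / k * erf xi).
Proof.
  intros Hl Hk Hrho Hc Hq Hh Hxi alpha.
  assert (Ha : 0 < alpha)
    by (apply Rdiv_lt_0_compat; [|apply Rmult_lt_0_compat]; lra).
  assert (Hca : rho * c = k / alpha)
    by (unfold alpha, diffusivity; field; lra).
  pose proof (sqrt_lt_R0 _ Ha) as Hsa.
  unfold explicit_solves_P. fold alpha.
  set (T := T_sol k q0 alpha xi). set (s := s_sol alpha xi).
  set (m := xi + gamma * k / (2 * q0 * sqrt alpha) * exp (xi ^ 2)).
  set (r := r_sol k gamma q0 alpha xi).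
  assert (Hs : forall t, 0 < t -> is_derive s t (xi * sqrt alpha / sqrt t))
    by (intros; now apply is_derive_free_boundary).
  assert (Hr : forall t, 0 < t -> is_derive r t (m * sqrt alpha / sqrt t))
    by (intros; now apply (is_derive_free_boundary m)).
  assert (Hx : forall x t, 0 < t -> is_derive (fun y => T y t) x
      (q0 / (k * sqrt t) * exp (- (x / (2 * sqrt (alpha * t))) ^ 2)))
    by (intros; now apply Dx_T_sol).
  assert (Hxx : forall x t, 0 < t -> is_derive (fun y => Defs.Dx T y t) x
      (- (q0 * x / (2 * alpha * k * t * sqrt t))
       * exp (- (x / (2 * sqrt (alpha * t))) ^ 2)))
    by (intros; now apply Dxx_T_sol).
  assert (Ht : forall x t, 0 < t -> is_derive (fun tau => T x tau) t
      (- (q0 * x / (2 * k * t * sqrt t))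
       * exp (- (x / (2 * sqrt (alpha * t))) ^ 2)))
    by (intros; now apply Dt_T_sol).
  assert (HDx : forall x t, 0 < t -> Defs.Dx T x t
      = q0 / (k * sqrt t) * exp (- (x / (2 * sqrt (alpha * t))) ^ 2))
    by (intros; now apply is_derive_unique, Hx).
  assert (HDxx : forall x t, 0 < t -> Dxx T x t
      = - (q0 * x / (2 * alpha * k * t * sqrt t))
        * exp (- (x / (2 * sqrt (alpha * t))) ^ 2))
    by (intros; now apply is_derive_unique, Hxx).
  assert (HDt : forall x t, 0 < t -> Dt T x t
      = - (q0 * x / (2 * k * t * sqrt t))
        * exp (- (x / (2 * sqrt (alpha * t))) ^ 2))
    by (intros; now apply is_derive_unique, Ht).
  assert (HDs : forall t, 0 < t -> Derive s t = xi * sqrt alpha / sqrt t)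
    by (intros; now apply is_derive_unique, Hs).
  assert (HDr : forall t, 0 < t -> Derive r t = m * sqrt alpha / sqrt t)
    by (intros; now apply is_derive_unique, Hr).
  assert (Hat : forall t, 0 < t -> 0 < sqrt (alpha * t))
    by (intros; apply sqrt_lt_R0; nra).
  (* The similarity variable is constant along the free boundary; this removes the time dependence
     from the conditions there. *)
  assert (Hss : forall t, 0 < t -> s t / (2 * sqrt (alpha * t)) = xi).
  { intros t Hpt. specialize (Hat t Hpt). unfold s, s_sol. field; lra. }
  assert (HTs : forall t, 0 < t -> T (s t) t = 0).
  { intros t Hpt. unfold T, T_sol. rewrite Hss by trivial. ring. }
  assert (HT0 : forall t, 0 < t -> T 0 t = - (q0 * sqrt (PI * alpha) / k * erf xi)).
  { intros t Hpt. unfold T, T_sol. unfold Rdiv at 2.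
    rewrite Rmult_0_l, erf_0. ring. }
  assert (HDxs : forall t, 0 < t ->
      Defs.Dx T (s t) t = q0 / (k * sqrt t) * exp (- xi ^ 2)).
  { intros t Hpt. now rewrite HDx, Hss. }
  assert (HDx0 : forall t, 0 < t -> Defs.Dx T 0 t = q0 / (k * sqrt t)).
  { intros t Hpt. rewrite HDx by trivial.
    replace (- (0 / (2 * sqrt (alpha * t))) ^ 2) with 0
      by (unfold Rdiv; ring).
    rewrite exp_0; ring. }
  assert (Hrs : forall t, 0 < t -> r t - s t
      = gamma * k / q0 * exp (xi ^ 2) * sqrt t).
  { intros t Hpt. unfold r, s, r_sol, s_sol. rewrite sqrt_mult by lra.
    field; lra. }
  (* The factor [exp (xi ^ 2)] in [r] cancels the decay of the flux at [s t], so the condition with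
     [gamma] holds identically. *)
  assert (Hexp : exp (- xi ^ 2) * exp (xi ^ 2) = 1).
  { rewrite <- exp_plus. replace (- xi ^ 2 + xi ^ 2) with 0 by ring.
    apply exp_0. }
  split.
  (* The conditions scale in [t], so the instant [t = 1] already yields both equations. *)
  - intros H. destruct (P_free_flux _ _ _ _ _ _ _ _ _ _ _ _ H 1 Rlt_0_1)
      as [Txs [Hlim [Hflux _]]].
    destruct (P_fixed_face _ _ _ _ _ _ _ _ _ _ _ _ H 1 Rlt_0_1)
      as [T0 [Tx0 [Hlim0 [_ [Hq1 Hq2]]]]].
    (* The explicit formulas are smooth across both faces, so by uniqueness of limits the one-sided
       boundary values in (P) are the values of these formulas. *)
    assert (Txs = Defs.Dx T (s 1) 1) as ->.
    { refine (filterlim_locally_unique _ _ _ Hlim _).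
      eapply (filterlim_within_derive _ (fun x => Defs.Dx T x 1)), Hxx; lra. }
    assert (T0 = T 0 1) as ->.
    { refine (filterlim_locally_unique _ _ _ Hlim0 _).
      eapply (filterlim_within_derive _ (fun x => T x 1)), Hx; lra. }
    rewrite HDxs, HDs, HDr, sqrt_1 in Hflux by lra.
    rewrite HT0 in Hq2 by lra. rewrite Hq1, sqrt_1 in Hq2. split.
    + replace (q0 * exp (- xi ^ 2))
        with (k * (q0 / (k * 1) * exp (- xi ^ 2))) by (field; lra).
      rewrite Hflux. unfold m. field. lra.
    + lra.
  - intros [Hflux Hconv]. split.
    + intros t Hpt. unfold s, s_sol. specialize (Hat t Hpt). nra.
    + intros x t Hpt _. split; [|split]; eexists; eauto.
    + intros x t Hpt _. rewrite HDxx, HDt, Hca by trivial.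
      pose proof (sqrt_lt_R0 _ Hpt). field. repeat split; lra.
    + intros t Hpt. split; eexists; eauto.
    + intros t Hpt. rewrite <- (HTs t Hpt).
      eapply (filterlim_within_derive _ (fun x => T x t)), Hx; lra.
    + intros t Hpt. exists (Defs.Dx T (s t) t). split; [|split].
      * eapply (filterlim_within_derive _ (fun x => Defs.Dx T x t)), Hxx; lra.
      * rewrite HDxs, HDs, HDr by trivial.
        pose proof (sqrt_lt_R0 _ Hpt).
        replace (k * (q0 / (k * sqrt t) * exp (- xi ^ 2)))
          with (q0 * exp (- xi ^ 2) / sqrt t) by (field; lra).
        rewrite Hflux. unfold m. field. lra.
      * rewrite HDxs, Hrs by trivial. pose proof (sqrt_lt_R0 _ Hpt).
        replace (q0 / (k * sqrt t) * exp (- xi ^ 2)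
                 * (gamma * k / q0 * exp (xi ^ 2) * sqrt t))
          with (gamma * (exp (- xi ^ 2) * exp (xi ^ 2))) by (field; lra).
        rewrite Hexp. ring.
    + unfold s, r, s_sol, r_sol. rewrite Rmult_0_r, sqrt_0.
      repeat split; try ring; apply free_boundary_initial.
    + intros t Hpt. pose proof (sqrt_lt_R0 _ Hpt).
      exists (T 0 t), (Defs.Dx T 0 t). split; [|split; [|split]].
      * eapply (filterlim_within_derive _ (fun x => T x t)), Hx; lra.
      * eapply (filterlim_within_derive _ (fun x => Defs.Dx T x t)), Hxx; lra.
      * rewrite HDx0 by trivial. field; lra.
      * rewrite HDx0, HT0 by trivial.
        replace (k * (q0 / (k * sqrt t))) with (q0 / sqrt t) by (field; lra).
        rewrite Hconv at 1. field; lra.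
Qed.

(** * From the two scalar equations to the formula for [c] and the equation for [f6] *)

Section Reduction.

Variables (l k rho gamma q0 h0 Dinf eps : R).
Hypotheses (Hl : 0 < l) (Hk : 0 < k) (Hrho : 0 < rho) (Hgamma : 0 < gamma)
  (Hq : 0 < q0) (Hh : 0 < h0) (HD : 0 < Dinf) (Heps : 0 < eps < 1).

(** The two conditions at the fixed face give [T(0,t) = - Dinf * B], so the sign of [B] is that of
    the temperature drop across the region. *)
Let B := 1 - q0 / (h0 * Dinf).

(** The equation is linear in the square root of the diffusivity and makes [B] a positive multiple
    of it, hence positive. *)
Lemma convective_condition_iff (c xi : R) : 0 < c -> 0 < xi ->
  q0 = h0 * (Dinf - q0 * sqrt (PI * diffusivity k rho c) / k * erf xi)
  <-> 0 < B /\ sqrt (diffusivity k rho c) = k * Dinf * B / (q0 * sqrt PI * erf xi).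
Proof.
  intros Hc Hxi. pose proof (erf_pos xi Hxi) as He. pose proof sqrt_PI_pos.
  assert (Ha : 0 < diffusivity k rho c)
    by (apply Rdiv_lt_0_compat; [|apply Rmult_lt_0_compat]; lra).
  apply sqrt_lt_R0 in Ha as Hsa.
  rewrite sqrt_mult by (try apply Rlt_le, PI_RGT_0; lra).
  set (a := sqrt (diffusivity k rho c)) in *.
  assert (HB : B = (Dinf - q0 / h0) / Dinf) by (unfold B; field; lra).
  assert (Hp : 0 < q0 * sqrt PI * erf xi)
    by (apply Rmult_lt_0_compat; [apply Rmult_lt_0_compat|]; lra).
  split.
  - intros E.
    assert (E' : B = a * (q0 * sqrt PI * erf xi) / (k * Dinf)).
    { rewrite HB. rewrite E at 1. field; lra. }
    split.
    + rewrite E'. apply Rdiv_lt_0_compat; nra.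
    + rewrite E'. field; lra.
  - intros [_ ->]. rewrite HB. field; lra.
Qed.

Lemma c_formula_iff (c xi : R) : 0 < c -> 0 < xi -> 0 < B ->
  sqrt (diffusivity k rho c) = k * Dinf * B / (q0 * sqrt PI * erf xi)
  <-> c = c_formula k rho q0 h0 Dinf xi.
Proof.
  intros Hc Hxi HB. pose proof (erf_pos xi Hxi) as He. pose proof sqrt_PI_pos.
  pose proof (sqrt_def PI (Rlt_le _ _ PI_RGT_0)) as HPI.
  assert (Ha : 0 < diffusivity k rho c)
    by (apply Rdiv_lt_0_compat; [|apply Rmult_lt_0_compat]; lra).
  assert (Hp : 0 < q0 * sqrt PI * erf xi)
    by (apply Rmult_lt_0_compat; [apply Rmult_lt_0_compat|]; lra).
  assert (HDB : 0 < Dinf * B) by (apply Rmult_lt_0_compat; lra).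
  (* Writing [PI] as a square lets [field] treat [sqrt PI] as the only atom. *)
  assert (Hcf : c_formula k rho q0 h0 Dinf xi
      = sqrt PI * sqrt PI / (rho * k) * (q0 * erf xi / (Dinf * B)) ^ 2)
    by now rewrite HPI.
  rewrite Hcf. clearbody B. split.
  - intros E.
    assert (Hc' : c = k / (rho * (sqrt (diffusivity k rho c)
                                  * sqrt (diffusivity k rho c)))).
    { rewrite sqrt_def by lra. unfold diffusivity. field; lra. }
    rewrite Hc', E. field. repeat split; lra.
  - intros ->. unfold diffusivity.
    replace (k / _) with ((k * Dinf * B / (q0 * sqrt PI * erf xi)) ^ 2).
    + apply sqrt_pow2, Rlt_le, Rdiv_lt_0_compat; nra.
    + field. repeat split; lra.
Qed.

(** With this value of [a], the two sides of the equation for [f6] are the two sides of the Stefan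
    condition multiplied by one common positive factor. *)
Lemma stefan_condition_iff (a xi : R) : 0 < xi -> 0 < B ->
  a = k * Dinf * B / (q0 * sqrt PI * erf xi) ->
  q0 * exp (- xi ^ 2)
  = rho * l * a * (xi + (1 - eps) * (gamma * k / (2 * q0 * a) * exp (xi ^ 2)))
  <-> f6_equation l k rho gamma q0 h0 Dinf eps xi.
Proof.
  intros Hxi HB ->. pose proof (erf_pos xi Hxi) as He. pose proof sqrt_PI_pos.
  unfold f6_equation, f6. fold B. rewrite exp_Ropp.
  pose proof (exp_pos (xi ^ 2)) as Hw. set (w := exp (xi ^ 2)) in *.
  clearbody B w.
  set (X := rho * l * _ * _). set (Y := (_ + _) * w). set (Z := q0 ^ 2 * _ / _).
  assert (HZ : Z = q0 * sqrt PI * w / (rho * l * k * Dinf * B) * (q0 * / w))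
    by (unfold Z; field; repeat split; lra).
  assert (HY : Y = q0 * sqrt PI * w / (rho * l * k * Dinf * B) * X)
    by (unfold X, Y; field; repeat split; lra).
  rewrite HY, HZ. split.
  - intros ->. reflexivity.
  - intros E. symmetry. eapply Rmult_eq_reg_l; [exact E|].
    apply Rgt_not_eq, Rdiv_lt_0_compat; repeat apply Rmult_lt_0_compat; lra.
Qed.

Lemma explicit_solves_P_iff_f6 (c xi : R) : 0 < c -> 0 < xi ->
  explicit_solves_P l k rho c gamma q0 h0 Dinf eps xi <->
  0 < B /\ f6_equation l k rho gamma q0 h0 Dinf eps xi
  /\ c = c_formula k rho q0 h0 Dinf xi.
Proof.
  intros Hc Hxi. rewrite explicit_solves_P_iff by lra.
  rewrite convective_condition_iff by lra. split.
  - intros [Hs [HB Ha]]. split; [trivial|]. split.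
    + revert Hs. now apply stefan_condition_iff.
    + revert Ha. now apply c_formula_iff.
  - intros [HB [Hf Ec]].
    assert (Ha := proj2 (c_formula_iff c xi Hc Hxi HB) Ec).
    split; [|now split]. now apply stefan_condition_iff.
Qed.

Lemma c_formula_pos (xi : R) : 0 < xi -> 0 < B ->
  0 < c_formula k rho q0 h0 Dinf xi.
Proof.
  intros Hxi HB. pose proof (erf_pos xi Hxi). pose proof PI_RGT_0.
  unfold c_formula. fold B.
  apply Rmult_lt_0_compat; [|apply pow_lt];
    apply Rdiv_lt_0_compat; trivial; apply Rmult_lt_0_compat; trivial.
Qed.

(** * Monotonicity, bounds and solvability of the equation for [f6] *)

Let C := gamma * sqrt PI * (1 - eps) / (2 * Dinf * B).
Let rhs := q0 ^ 2 * sqrt PI / (rho * l * k * Dinf * B).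

Lemma C_pos : 0 < B -> 0 < C.
Proof.
  intros HB. pose proof sqrt_PI_pos. unfold C.
  apply Rdiv_lt_0_compat; repeat apply Rmult_lt_0_compat; lra.
Qed.

(** Strictness comes from the exponentials and [C > 0], so weak monotonicity of [x / erf x] is
    enough. *)
Lemma f6_increasing (x y : R) : 0 < B -> 0 < x < y ->
  f6 gamma q0 h0 Dinf eps x < f6 gamma q0 h0 Dinf eps y.
Proof.
  intros HB Hxy. unfold f6. fold B. fold C. pose proof (C_pos HB) as HC.
  pose proof (id_div_erf_le x y Hxy) as H1.
  pose proof (id_div_erf_bounds x ltac:(lra)) as [H2 _].
  pose proof sqrt_PI_pos. pose proof (exp_pos (x ^ 2)).
  assert (exp (x ^ 2) < exp (y ^ 2)) by (apply exp_increasing; nra).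
  apply Rmult_le_0_lt_compat; nra.
Qed.

Lemma f6_lower_bound (x : R) : 0 < B -> 0 < x ->
  (sqrt PI / 2 + C) * exp (x ^ 2) <= f6 gamma q0 h0 Dinf eps x.
Proof.
  intros HB Hx. unfold f6. fold B. fold C. pose proof (C_pos HB) as HC.
  pose proof (id_div_erf_bounds x Hx) as [H _].
  assert (1 <= exp (x ^ 2)) by (rewrite <- exp_0; left; apply exp_increasing; nra).
  apply Rmult_le_compat_r; nra.
Qed.

(** The upper bound on [x / erf x] carries the same factor [exp (x ^ 2)] as the [C] term, so the
    whole bracket is at most [sqrt PI / 2 + C] times that factor. *)
Lemma f6_upper_bound (x : R) : 0 < x ->
  f6 gamma q0 h0 Dinf eps x <= (sqrt PI / 2 + C) * exp (2 * x ^ 2).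
Proof.
  intros Hx. unfold f6. fold B. fold C.
  pose proof (id_div_erf_bounds x Hx) as [_ H].
  pose proof (exp_pos (x ^ 2)).
  replace (2 * x ^ 2) with (x ^ 2 + x ^ 2) by ring. rewrite exp_plus. nra.
Qed.

(** The gaps in the two inequalities are proportional, with positive factor [sqrt PI / (2 * B)]. *)
Lemma second_inequality_iff : 0 < B ->
  B < 1 / Dinf * (2 * q0 ^ 2 / (rho * l * k) - gamma * (1 - eps))
  <-> sqrt PI / 2 + C < rhs.
Proof.
  intros HB. pose proof sqrt_PI_pos.
  set (Z := 1 / Dinf * _).
  assert (HC : rhs - (sqrt PI / 2 + C) = sqrt PI / (2 * B) * (Z - B)).
  { unfold rhs, C, Z. clearbody B. field. repeat split; lra. }
  assert (0 < sqrt PI / (2 * B)) by (apply Rdiv_lt_0_compat; lra).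
  split; intros; nra.
Qed.

Lemma f6_solution_exists : 0 < B -> sqrt PI / 2 + C < rhs ->
  exists xi, 0 < xi /\ f6_equation l k rho gamma q0 h0 Dinf eps xi.
Proof.
  intros HB Hlt. pose proof (C_pos HB) as HC. pose proof sqrt_PI_pos.
  set (A := sqrt PI / 2 + C) in *.
  assert (HA : 0 < A) by (unfold A; lra).
  assert (Hq1 : 1 < rhs / A) by (apply Rlt_div_r; lra).
  assert (HL : 0 < ln (rhs / A)) by (rewrite <- ln_1; apply ln_increasing; lra).
  (* The upper bound of [f6] is below [rhs] where [x ^ 2 = ln (rhs / A) / 4], and
     the lower bound is above [rhs] where [y ^ 2 = 2 * ln (rhs / A)]. *)
  set (x := sqrt (ln (rhs / A) / 4)). set (y := sqrt (2 * ln (rhs / A))).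
  assert (Hx : 0 < x) by (apply sqrt_lt_R0; lra).
  assert (Hxy : x < y) by (apply sqrt_lt_1; lra).
  assert (Hx2 : x ^ 2 = ln (rhs / A) / 4) by (apply pow2_sqrt; lra).
  assert (Hy2 : y ^ 2 = 2 * ln (rhs / A)) by (apply pow2_sqrt; lra).
  assert (Hrhs : A * exp (ln (rhs / A)) = rhs)
    by (rewrite exp_ln by lra; field; lra).
  assert (Hlow : f6 gamma q0 h0 Dinf eps x < rhs).
  { eapply Rle_lt_trans; [now apply f6_upper_bound|]. fold A.
    rewrite <- Hrhs, Hx2. apply Rmult_lt_compat_l; [trivial|].
    apply exp_increasing; lra. }
  assert (Hhigh : rhs < f6 gamma q0 h0 Dinf eps y).
  { eapply Rlt_le_trans; [|apply f6_lower_bound; lra]. fold A.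
    rewrite <- Hrhs, Hy2. apply Rmult_lt_compat_l; [trivial|].
    apply exp_increasing; lra. }
  destruct (Ranalysis5.IVT_interv (fun z => f6 gamma q0 h0 Dinf eps z - rhs) x y)
    as [z [Hz Ez]]; try lra.
  - intros z Hz. apply continuity_pt_filterlim.
    apply (ex_derive_continuous (fun z => f6 gamma q0 h0 Dinf eps z - rhs)).
    pose proof (erf_pos z ltac:(lra)).
    unfold f6. auto_derive. repeat split; try lra.
    eexists; apply is_derive_erf.
  - exists z. split; [lra|]. unfold f6_equation. fold B. fold rhs. lra.
Qed.

(** Since [exp (xi ^ 2) > 1], the lower bound keeps [f6] strictly above its limit [sqrt PI / 2 + C]
    at zero. *)
Lemma f6_equation_lt (xi : R) : 0 < B -> 0 < xi ->
  f6_equation l k rho gamma q0 h0 Dinf eps xi -> sqrt PI / 2 + C < rhs.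
Proof.
  intros HB Hxi E. unfold f6_equation in E. fold B in E. fold rhs in E.
  pose proof (f6_lower_bound xi HB Hxi). pose proof (C_pos HB).
  pose proof sqrt_PI_pos.
  assert (1 < exp (xi ^ 2)) by (rewrite <- exp_0; apply exp_increasing; nra).
  nra.
Qed.

Lemma f6_equation_unique (x y : R) : 0 < B -> 0 < x -> 0 < y ->
  f6_equation l k rho gamma q0 h0 Dinf eps x ->
  f6_equation l k rho gamma q0 h0 Dinf eps y -> x = y.
Proof.
  unfold f6_equation. intros HB Hx Hy Ex Ey.
  destruct (Rtotal_order x y) as [H|[H|H]]; trivial; exfalso.
  - pose proof (f6_increasing x y HB ltac:(lra)). lra.
  - pose proof (f6_increasing y x HB ltac:(lra)). lra.
Qed.

End Reduction.

Theorem theorem3p6 :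
  forall (l k rho gamma q0 h0 Dinf eps : R),
    0 < l -> 0 < k -> 0 < rho -> 0 < gamma -> 0 < q0 -> 0 < h0 -> 0 < Dinf ->
    0 < eps < 1 ->
    ((exists c xi : R, 0 < c /\ 0 < xi /\
        explicit_solves_P l k rho c gamma q0 h0 Dinf eps xi)
     <-> data_inequalities l k rho gamma q0 h0 Dinf eps)
    /\
    (data_inequalities l k rho gamma q0 h0 Dinf eps ->
       (exists! xi : R, 0 < xi /\ f6_equation l k rho gamma q0 h0 Dinf eps xi)
       /\
       (forall c xi : R, 0 < c -> 0 < xi ->
          (explicit_solves_P l k rho c gamma q0 h0 Dinf eps xi
           <-> f6_equation l k rho gamma q0 h0 Dinf eps xi
               /\ c = c_formula k rho q0 h0 Dinf xi))).
Proof.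
  intros l k rho gamma q0 h0 Dinf eps Hl Hk Hrho Hgamma Hq Hh HD Heps.
  assert (Hex : data_inequalities l k rho gamma q0 h0 Dinf eps ->
    exists xi, 0 < xi /\ f6_equation l k rho gamma q0 h0 Dinf eps xi).
  { intros [HB Hlt]. apply f6_solution_exists; trivial.
    now apply second_inequality_iff. }
  split; [split|].
  - intros [c [xi [Hc [Hxi Hsol]]]].
    apply explicit_solves_P_iff_f6 in Hsol as [HB [Hf _]]; trivial.
    split; [trivial|]. apply second_inequality_iff; trivial.
    now apply f6_equation_lt with xi.
  - intros Hdata. destruct (Hex Hdata) as [xi [Hxi Hf]].
    destruct Hdata as [HB _].
    assert (Hc : 0 < c_formula k rho q0 h0 Dinf xi) by now apply c_formula_pos.
    exists (c_formula k rho q0 h0 Dinf xi), xi. repeat (split; [trivial|]).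
    now apply explicit_solves_P_iff_f6.
  - intros Hdata. split.
    + destruct (Hex Hdata) as [xi [Hxi Hf]]. exists xi. split; [now split|].
      intros y [Hy Hfy]. destruct Hdata as [HB _].
      now apply (f6_equation_unique l k rho gamma q0 h0 Dinf eps).
    + intros c xi Hc Hxi. rewrite explicit_solves_P_iff_f6 by trivial.
      destruct Hdata as [HB _]. tauto.
Qed.
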